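(* Let $\sigma^*$ be a function on $V$ with $0<\sigma^*_{\min}\le\sigma^*({\bf r})\le\sigma^*_{\max}$ for all ${\bf r}\in V$. Then the operator $\mathcal{K}\sigma^*$ (multiplication by $\sigma^*$ followed by $\mathcal{K}$), acting on $L^2(V)$ equipped with the weighted norm $\|\cdot\|_{L^2(V,\sigma)}$, satisfies $$\|\mathcal{K}\sigma^*\|_{L^2(V,\sigma)}\le\Big\|\frac{\sigma^*}{\sigma}\Big\|_{L^\infty(V)}.$$
   Context: Setting: $V\subset\mathbb{R}^3$ is a bounded convex domain, and $\mathbb{S}^2$ is the unit sphere in $\mathbb{R}^3$. The scattering and absorption cross-sections $\sigma_S,\sigma_A$ are functions on $V$ satisfying $0<(\sigma_S)_{\min}\le\sigma_S({\bf r})\le(\sigma_S)_{\max}$ and $0<(\sigma_A)_{\min}\le\sigma_A({\bf r})\le(\sigma_A)_{\max}$ for all ${\bf r}\in V$, and the total cross-section is $\sigma=\sigma_S+\sigma_A$, so $0<\sigma_{\min}\le\sigma({\bf r})\le\sigma_{\max}$. The optical path length is $\tau({\bf r},{\bf r}')=\int_{l({\bf r},{\bf r}')}\sigma({\bf z})\,\mathrm{d}{\bf z}$, the integral of $\sigma$ along the line segment $l({\bf r},{\bf r}')$ joining ${\bf r}$ and ${\bf r}'$. The integral operator $\mathcal{K}$ is $(\mathcal{K}v)({\bf r})=\int_V k({\bf r},{\bf r}')v({\bf r}')\,\mathrm{d}{\bf r}'$ with kernel $k({\bf r},{\bf r}')=\dfrac{\exp(-\tau({\bf r},{\bf r}'))}{4\pi\|{\bf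 r}-{\bf r}'\|_2^2}$. For a weight $w$ bounded above and below by positive constants, $\|v\|_{L^2(V,w)}^2=\int_V|v({\bf r})|^2w({\bf r})\,\mathrm{d}{\bf r}$; the operator norm on the left is with respect to this norm with $w=\sigma$. *)

(* Defs.v *)
From HB Require Import structures.
From mathcomp Require Import all_boot all_order all_algebra.
From mathcomp Require Import all_classical all_reals all_analysis ess_sup_inf.
Set Implicit Arguments. Unset Strict Implicit. Unset Printing Implicit Defensive.
Import Order.TTheory GRing.Theory Num.Theory numFieldNormedType.Exports.
Local Open Scope classical_set_scope.
Local Open Scope ring_scope.

Definition pt (R : realType) := ((R * R) * R)%type.

Section Defs.
Variable R : realType.

Definition padd (p q : pt R) : pt R := ((p.1.1 + q.1.1, p.1.2 + q.1.2), p.2 + q.2).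
Definition psub (p q : pt R) : pt R := ((p.1.1 - q.1.1, p.1.2 - q.1.2), p.2 - q.2).
Definition pscale (t : R) (p : pt R) : pt R := ((t * p.1.1, t * p.1.2), t * p.2).

Definition enorm (p : pt R) : R := Num.sqrt (p.1.1 ^+ 2 + p.1.2 ^+ 2 + p.2 ^+ 2).

Definition leb1 := @lebesgue_measure R.
Definition leb3 := ((leb1 \x leb1) \x leb1)%E.

Definition convex_set3 (V : set (pt R)) : Prop :=
  forall x y, V x -> V y -> forall t : R, 0 <= t <= 1 -> V (padd x (pscale t (psub y x))).

Definition bounded_set3 (V : set (pt R)) : Prop :=
  exists M : R, forall x, V x -> enorm x <= M.

(* optical path length: integral of sig along the segment l(r, r'), w.r.t. arc length,
   parametrised as z = r + t (r' - r), t in [0,1], dz = ||r' - r|| dt *)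
Definition tau (sig : pt R -> R) (r r' : pt R) : R :=
  (Rintegral leb1 `[0%R, 1%R]
     (fun t => sig (padd r (pscale t (psub r' r))))) * enorm (psub r' r).

Definition kern (sig : pt R -> R) (r r' : pt R) : R :=
  expR (- tau sig r r') / (4 * pi * (enorm (psub r r')) ^+ 2).

Definition Kop (V : set (pt R)) (sig : pt R -> R) (v : pt R -> R) (r : pt R) : R :=
  Rintegral leb3 V (fun r' => kern sig r r' * v r').

Definition Ksig (V : set (pt R)) (sig sigstar : pt R -> R) (v : pt R -> R) : pt R -> R :=
  Kop V sig (fun r' => sigstar r' * v r').

Definition wL2sq (V : set (pt R)) (w v : pt R -> R) : \bar R :=
  (\int[leb3]_(x in V) ((`|v x| ^+ 2 * w x)%:E))%E.

End Defs.
Arguments leb3 {R}.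

(* Main.v *)
Require Import Defs.
From HB Require Import structures.
From mathcomp Require Import all_boot all_order all_algebra.
From mathcomp Require Import all_classical all_reals all_analysis ess_sup_inf measurable_realfun.
From mathcomp Require Import ring lra.
Import Order.TTheory GRing.Theory Num.Theory numFieldNormedType.Exports.
Local Open Scope classical_set_scope.
Local Open Scope ring_scope.

(** By the Schur test, a symmetric kernel [k] with [\int k(r,x) sigma(x) dx <= 1]
    defines, after multiplication by [sigma], a contraction of [L^2(sigma)]; the
    factor [sigma^* / sigma] is then bounded by its essential supremum. The
    normalisation of the transport kernel needs no spherical coordinates:
    substituting [x = r + z (a, b, 1)], with volume element [z^2 dz da db], and
    writing [q = |(a, b, 1)|] and [g(z) = sigma (r + z (a, b, 1))], the factor
    [z^2] cancels the singularity, the integral in [z] of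
    [g(z) exp (- q |\int_0^z g|)] is at most [2 / q], and what remains is
    [1 / (2 pi) \int\int (1 + a^2 + b^2)^(-3/2) da db = 1]. *)

(** * Affine substitution on the line *)

Section affine.
Context {R : realType}.
Local Notation mu := (@lebesgue_measure R).

(** The pushforward of Lebesgue measure under [y |-> d + c y], scaled by [|c|], agrees with Lebesgue
    measure on half-open intervals, and uniqueness extends this to all measurable sets. *)
Lemma lebesgue_measure_affine (c d : R) (A : set R) : c != 0 -> measurable A ->
  (`|c|%:E * mu ((fun y => d + c * y)%R @^-1` A))%E = mu A.
Proof.
move=> c0 mA.
have mphi : measurable_fun [set: measurableTypeR R]
    ((fun y => d + c * y)%R : _ -> measurableTypeR R).
  by apply: measurable_funD => //; exact: measurable_funM.
pose nu := mscale (NngNum (normr_ge0 c)) (pushforward mu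
  ((fun y => d + c * y)%R : measurableTypeR R -> measurableTypeR R)).
suff -> : mu A = nu mphi A by [].
apply: lebesgue_measure_unique => // _ [[a b]] _ <-.
change (mu `]a, b] = (`|c|%:E * mu ((fun y => d + c * y)%R @^-1` `]a, b]))%E).
case: (ltgtP c 0) c0 => // c0 _.
  (* A negative slope reverses the interval, so the closed end of the preimage is the left one. *)
  rewrite [X in (_ * _ X)%E](_ : _ =
    `[((b - d) / c), ((a - d) / c)[%classic); last first.
    apply/seteqP; split => y /=; rewrite !in_itv/= ?ler_ndivrMr ?ltr_ndivlMr//.
    + move=> /andP[? ?]; apply/andP; split; lra.
    + move=> /andP[? ?]; apply/andP; split; lra.
  rewrite !lebesgue_measure_itv/= !lte_fin.
  rewrite ltr_nM2r ?invr_lt0// ltrD2r (ltr0_norm c0).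
  case: ifPn => _; last by rewrite mule0.
  by rewrite -!EFinD -EFinM; congr EFin; field; rewrite lt_eqF.
rewrite [X in (_ * _ X)%E](_ : _ =
  `]((a - d) / c), ((b - d) / c)]%classic); last first.
  apply/seteqP; split => y /=; rewrite !in_itv/= ?ler_pdivlMr ?ltr_pdivrMr//.
  + move=> /andP[? ?]; apply/andP; split; lra.
  + move=> /andP[? ?]; apply/andP; split; lra.
rewrite !lebesgue_measure_itv/= !lte_fin.
rewrite ltr_pM2r ?invr_gt0// ltrD2r (gtr0_norm c0).
case: ifPn => _; last by rewrite mule0.
by rewrite -!EFinD -EFinM; congr EFin; field; rewrite gt_eqF.
Qed.

Lemma ge0_integral_affine (c d : R) (f : R -> \bar R) : c != 0 ->
  measurable_fun setT f -> (forall x, 0 <= f x)%E ->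
  (\int[mu]_x f x = `|c|%:E * \int[mu]_y f (d + c * y)%R)%E.
Proof.
move=> c0 mf f0.
have mphi : measurable_fun [set: measurableTypeR R]
    ((fun y => d + c * y)%R : _ -> measurableTypeR R).
  by apply: measurable_funD => //; exact: measurable_funM.
pose nu := mscale (NngNum (normr_ge0 c)) (pushforward mu
  ((fun y => d + c * y)%R : measurableTypeR R -> measurableTypeR R)).
transitivity (\int[nu mphi]_x f x)%E.
  apply: eq_measure_integral => A mA _.
  exact/esym/lebesgue_measure_affine.
rewrite ge0_integral_mscale//=.
by rewrite ge0_integral_pushforward.
Qed.

End affine.

(** * Exponential attenuation along a ray *)

Section exp_bound.
Context {R : realType}.
Local Notation mu := (@lebesgue_measure R).
Variables (g : R -> R) (C s : R).
Hypotheses (mg : measurable_fun setT g) (g0 : forall x, 0 <= g x)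
  (gC : forall x, g x <= C) (s0 : 0 < s).

(** The optical depth of a ray up to [x]. The interval is empty for negative [x], so [G] is [0]
    there and is a function on the whole line. *)
Let G x := Rintegral mu `[0, x] g.

Lemma bounded_integrable_itv (a b : R) : mu.-integrable `[a, b] (EFin \o g).
Proof.
apply: measurable_bounded_integrable => //.
- by rewrite /= lebesgue_measure_itv/=; case: ifPn; rewrite ltry.
- exact: measurable_funTS.
- exists C; split; first by rewrite num_real.
  by move=> x Cx y _ /=; rewrite ger0_norm// (le_trans (gC y))// ltW.
Qed.

Let C0 : 0 <= C. Proof. exact: le_trans (g0 0) (gC 0). Qed.

Lemma primitive_split (x y : R) : 0 <= x <= y ->
  G y = G x + Rintegral mu `]x, y] g.
Proof.
move=> /andP[x0 xy].
rewrite /G.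
have := @Rintegral_itvB R g (BLeft 0) (BRight y) x (bounded_integrable_itv 0 y).
rewrite !bnd_simp x0 xy => /(_ erefl erefl) <-.
by rewrite addrC subrK.
Qed.

Lemma primitive_incr (x y : R) : 0 <= x <= y ->
  0 <= G y - G x <= C * (y - x).
Proof.
move=> xy; rewrite (primitive_split _ _ xy) addrAC subrr add0r.
rewrite Rintegral_ge0//=.
have [x0 lexy] := andP xy.
have : Rintegral mu `]x, y] g <= Rintegral mu `]x, y] (cst C).
  apply: le_Rintegral => //.
  - by apply: integrableS (bounded_integrable_itv x y) => //; exact: subset_itv_oc_cc.
  - apply: measurable_bounded_integrable => //.
      by rewrite /= lebesgue_measure_itv/=; case: ifPn; rewrite ltry.
    by exists C; split; [rewrite num_real|move=> z Cz w _ /=; rewrite ger0_norm// ltW].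
rewrite Rintegral_cst//= lebesgue_measure_itv/= lte_fin.
by move: lexy; rewrite le_eqVlt => /predU1P[->|->//]; rewrite ltxx subrr.
Qed.

Let H x := (g x * expR (- (s * G x)))%:E.

Lemma primitive_le0 x : x <= 0 -> G x = 0.
Proof.
rewrite /G le_eqVlt => /predU1P[->|x0]; first by rewrite set_itv1 Rintegral_set1.
by rewrite set_itv_ge ?Rintegral_set0// bnd_simp -ltNge.
Qed.

(** Gives the continuity, hence the measurability, of [G]. Across [0] the bound survives because [G]
    is constant on the negative side. *)
Lemma primitive_lipschitz (x y : R) : `|G x - G y| <= C * `|x - y|.
Proof.
wlog xy : x y / x <= y.
  move=> wl; case: (leP x y) => [|/ltW] xy; first exact: wl.
  by rewrite distrC (distrC x); exact: wl.
rewrite distrC (distrC x) (ger0_norm (_ : 0 <= y - x)) ?subr_ge0//.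
case: (leP 0 x) => [x0|/ltW x0].
  have /andP[? ?] := primitive_incr x y ltac:(by rewrite x0).
  by rewrite ger0_norm.
rewrite (primitive_le0 _ x0); case: (leP 0 y) => [y0|/ltW y0].
  have /andP[] := primitive_incr 0 y ltac:(by rewrite lexx).
  rewrite (primitive_le0 0)// !subr0 => G0 GC.
  by rewrite ger0_norm// (le_trans GC)// ler_wpM2l// lerDl oppr_ge0.
by rewrite (primitive_le0 _ y0) subrr normr0 mulr_ge0// subr_ge0.
Qed.

Lemma measurable_primitive : measurable_fun setT G.
Proof.
apply: continuous_measurable_fun => x; apply/cvgrPdist_le => e e0.
near=> y.
apply: (le_trans (primitive_lipschitz _ _)).
(* [C] may be zero, hence the divisor [C + 1]. *)
have : `|x - y| <= e / (C + 1).
  by near: y; apply: cvgr_dist_le => //; rewrite divr_gt0// ltr_wpDl.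
rewrite ler_pdivlMr; last by rewrite ltr_wpDl.
have := normr_ge0 (x - y); nra.
Unshelve. all: by end_near. Qed.

Lemma measurable_exp_primitive : measurable_fun setT H.
Proof.
apply/measurable_EFinP/measurable_funM => //.
apply: measurableT_comp => //; apply: measurableT_comp => //.
by apply: measurable_funM => //; exact: measurable_primitive.
Qed.

(* On a step of length h the primitive grows by at most C h, and
   u <= e^u (1 - e^(-u)). *)
Lemma integral_exp_step (x h : R) : 0 <= x -> 0 < h ->
  (\int[mu]_(y in `]x, (x + h)%R]) H y <=
   (expR (s * (C * h)) / s *
     (expR (- (s * G x)) - expR (- (s * G (x + h)))))%:E)%E.
Proof.
move=> x0 h0.
have lxh : 0 <= x <= x + h by rewrite x0 lerDl ltW.
have /andP[] := primitive_incr _ _ lxh.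
rewrite addrAC subrr add0r; set D := G (x + h) - G x => D0 DC.
(* [G] is nondecreasing, so the exponential is largest at the left end of the step. *)
apply: (@le_trans _ _ (\int[mu]_(y in `]x, (x + h)%R]) (expR (- (s * G x)) * g y)%:E)%E).
  apply: ge0_le_integral => //=.
  - by move=> y _; rewrite lee_fin mulr_ge0// expR_ge0.
  - exact: measurable_funS measurable_exp_primitive.
  - by apply/measurable_EFinP/measurable_funM => //; exact: measurable_funTS.
  - move=> y; rewrite in_itv/= => /andP[xy yh].
    rewrite lee_fin mulrC ler_wpM2r// ler_expR lerN2 ler_pM2l//.
    by have := primitive_incr x y; rewrite x0 ltW// subr_ge0 => /(_ erefl)/andP[].
under eq_integral do rewrite EFinM.
rewrite ge0_integralZl_EFin ?expR_ge0//=; first last.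
- by apply/measurable_EFinP; exact: measurable_funTS.
- by move=> y _; rewrite lee_fin.
rewrite [X in (_ * X)%E](_ : _ = D%:E); last first.
  rewrite /D (primitive_split _ _ lxh) addrAC subrr add0r /Rintegral fineK//.
  apply: integrable_fin_num => //.
  apply: integrableS (bounded_integrable_itv x (x + h)) => //.
  exact: subset_itv_oc_cc.
rewrite -EFinM lee_fin.
have -> : G (x + h) = G x + D by rewrite /D subrKC.
have -> : expR (- (s * (G x + D))) = expR (- (s * G x)) * expR (- (s * D)).
  by rewrite -expRD mulrDr opprD.
set a := expR (- (s * G x)); set b := expR (- (s * D)).
rewrite (_ : _ * (a - a * b) = a * (expR (s * (C * h)) * (1 - b) / s)); last by ring.
rewrite ler_wpM2l ?expR_ge0// ler_pdivlMr//.
have e1 := expR_ge1Dx (s * D).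
have e2 : expR (s * D) <= expR (s * (C * h)) by rewrite ler_expR ler_pM2l.
have e3 : expR (- (s * D)) * expR (s * D) = 1 by rewrite -expRD addNr expR0.
have e4 : expR (- (s * D)) <= 1 by rewrite -expR0 ler_expR oppr_le0 mulr_ge0// ltW.
have e5 : 0 <= (expR (s * (C * h)) - expR (s * D)) * (1 - b).
  by rewrite mulr_ge0// subr_ge0.
rewrite -/b in e3 e4; lra.
Qed.

(** The differences of [exp (- s G)] over consecutive steps telescope, so the error factor
    [exp (s C h)] occurs once, whatever the number of steps. *)
Lemma integral_exp_steps (h : R) (n : nat) : 0 < h ->
  (\int[mu]_(y in `]0%R, (n%:R * h)%R]) H y <=
   (expR (s * (C * h)) / s * (1 - expR (- (s * G (n%:R * h)))))%:E)%E.
Proof.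
move=> h0; elim: n => [|n IH].
  by rewrite mul0r set_itvoc0 integral_set0 /G set_itv1 Rintegral_set1 mulr0
    oppr0 expR0 subrr mulr0.
have nh : 0 <= n%:R * h by rewrite mulr_ge0// ltW.
have -> : n.+1%:R * h = n%:R * h + h by rewrite -natr1 mulrDl mul1r.
move: (n%:R * h) nh IH => u u0 IH.
have -> : `]0, (u + h)]%classic = `]0, u]%classic `|` `]u, (u + h)]%classic.
  by apply: itv_bndbnd_setU; rewrite bnd_simp// lerDl ltW.
rewrite ge0_integral_setU//=; last 3 first.
- exact: measurable_funS measurable_exp_primitive.
- by move=> y _; rewrite lee_fin mulr_ge0// expR_ge0.
- apply/disj_setPS => y /= []; rewrite !in_itv/= => /andP[_ yn] /andP[ny _].
  by move: (lt_le_trans ny yn); rewrite ltxx.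
apply: le_trans (leeD IH (integral_exp_step _ _ u0 h0)) _.
rewrite -EFinD lee_fin -mulrDr; apply: ler_wpM2l; last lra.
by rewrite divr_ge0// ?expR_ge0// ltW.
Qed.

(** Formally the integrand is the derivative of [- exp (- s G) / s], but [g] is merely measurable.
    On []0, n]] the step bound is used with a mesh tending to [0], which drives the error factor to
    [1]; monotone convergence then lets [n] grow. *)
Lemma integral_exp_le : (\int[mu]_(y in `[0%R, +oo[) H y <= (s^-1)%:E)%E.
Proof.
rewrite -integral_itv_obnd_cbnd; last exact: measurable_funS measurable_exp_primitive.
rewrite itv_bndy_bigcup_BRight.
have H0 y : (0 <= H y)%E by rewrite lee_fin mulr_ge0// expR_ge0.
apply: (cvge_to_le (ge0_nondecreasing_set_cvg_integral _ _ _ _)).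
- move=> m n mn; apply/subsetPset; apply: subset_itvl.
  by rewrite bnd_simp lerD2l ler_nat.
- by move=> i.
- by move=> i; exact: measurable_funS measurable_exp_primitive.
- by move=> *; exact: H0.
near=> n.
(* [harmonic k] is [1 / (k + 1)]: the mesh is [n / (k + 1)], taken [k + 1] times. *)
have cvg0 : (s * C * n%:R) * (@harmonic R k) @[k --> \oo] --> s * C * n%:R * 0.
  exact: cvgMl_tmp cvg_harmonic.
have cvg1 : expR (s * C * n%:R * @harmonic R k) / s @[k --> \oo] --> 1 / s.
  apply: cvgMr_tmp.
  rewrite [X in _ --> X](_ : 1 = expR (s * C * n%:R * 0)); last by rewrite mulr0 expR0.
  by apply: continuous_cvg; [exact: continuous_expR|exact: cvg0].
have {}cvg1 : (expR (s * C * n%:R * @harmonic R k) / s)%:E @[k --> \oo] --> (s^-1)%:E.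
  by rewrite -[X in X%:E]mul1r; apply: cvg_EFin => //; near=> k.
apply: (cvge_to_ge cvg1); near=> k.
have h0 : 0 < n%:R * k.+1%:R^-1 :> R.
  by rewrite divr_gt0// ltr0n; near: n; exact: nbhs_infty_gt.
have := integral_exp_steps _ k.+1 h0.
rewrite mulrCA divff ?mulr1 ?pnatr_eq0// add0r => /le_trans; apply.
rewrite lee_fin (_ : s * C * n%:R * harmonic k = s * (C * (n%:R / k.+1%:R))).
  2: by rewrite /harmonic /= !mulrA.
rewrite -[leRHS]mulr1; apply: ler_wpM2l.
  by rewrite divr_ge0 ?expR_ge0// ltW.
by rewrite gerBl expR_ge0.
Unshelve. all: by end_near. Qed.

End exp_bound.

(** * Attenuation along a full line through the origin of the ray *)

Section exp_bound_line.
Context {R : realType}.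
Local Notation mu := (@lebesgue_measure R).

(** Passes from the parametrisation of a segment by [[0, 1]], as in [tau], to the position along the
    ray. The substitution [t |-> z t] requires [z != 0], so [z = 0] is treated apart. *)
Lemma Rintegral_rescale (g : R -> R) (C z : R) : measurable_fun setT g ->
  (forall x, 0 <= g x) -> (forall x, g x <= C) -> 0 <= z ->
  z * Rintegral mu `[0, 1] (fun t : R => g (t * z)) = Rintegral mu `[0, z] g.
Proof.
move=> mg g0 gC; rewrite le_eqVlt => /predU1P[<-|z0].
  by rewrite mul0r set_itv1 Rintegral_set1.
have mgz : measurable_fun setT (fun t : R => g (t * z)).
  by apply: measurableT_comp => //; exact: measurable_funM.
rewrite /Rintegral [in RHS]integral_mkcond.
rewrite (@ge0_integral_affine R z 0) ?gt_eqF//; last 2 first.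
- by apply/(measurable_restrictT _ _).1 => //; exact/measurable_EFinP/measurable_funTS.
- by move=> x; rewrite /= patchE; case: ifPn => // _; rewrite lee_fin.
rewrite (gtr0_norm z0).
rewrite [X in (_ * X)%E](_ : _ = \int[mu]_(t in `[0%R, 1%R]) (g (t * z)%R)%:E)%E.
  rewrite fineM//.
  apply: integrable_fin_num => //.
  exact: (@bounded_integrable_itv _ (fun t : R => g (t * z)) C).
rewrite [in RHS]integral_mkcond; apply: eq_integral => t _.
rewrite !patchE add0r (mulrC t).
have -> // : (z * t \in `[0, z]%classic) = (t \in `[0, 1]%classic).
by rewrite !mem_setE !in_itv/= pmulr_rge0// -{2}(mulr1 z) ler_pM2l.
Qed.

Let H (g : R -> R) (s x : R) := (g x * expR (- (s * Rintegral mu `[0, x] g)))%:E.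

(** Reduces the line to two rays from [0]: the negative one becomes a positive ray for the reflected
    profile [g (- x)]. *)
Lemma exp_line_half_lines (g : R -> R) (C s z : R) : measurable_fun setT g ->
  (forall x, 0 <= g x) -> (forall x, g x <= C) ->
  (g z * expR (- (s * (`|z| * Rintegral mu `[0, 1] (fun t : R => g (t * z))))))%:E =
  if 0 <= z then H g s z else H (fun x : R => g (- x)) s (- z).
Proof.
move=> mg g0 gC; case: ifPn => z0.
  by rewrite ger0_norm// (Rintegral_rescale _ C).
have mg' : measurable_fun setT (fun x : R => g (- x)) by apply: measurableT_comp.
rewrite ltr0_norm ?ltNge// /H -(Rintegral_rescale _ C) ?oppr_ge0 1?ltW ?ltNge//.
rewrite opprK; do 6 f_equal.
by apply: eq_Rintegral => t _; rewrite mulrN opprK.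
Qed.

Lemma measurable_exp_line (g : R -> R) (C s : R) : measurable_fun setT g ->
  (forall x, 0 <= g x) -> (forall x, g x <= C) ->
  measurable_fun setT (fun z => (g z *
    expR (- (s * (`|z| * Rintegral mu `[0, 1] (fun t : R => g (t * z))))))%:E).
Proof.
move=> mg g0 gC; under eq_fun do rewrite (exp_line_half_lines _ C)//.
have mg' : measurable_fun setT (fun x : R => g (- x)) by apply: measurableT_comp.
apply: measurable_fun_ifT; first exact: measurable_fun_ler.
  exact: measurable_exp_primitive mg g0 gC.
have m' := measurable_exp_primitive _ C s mg' (fun x => g0 _) (fun x => gC _).
exact: measurableT_comp m' (@oppr_measurable R setT).
Qed.

(** Each of the two rays from [0] contributes at most [1 / s]. *)
Lemma integral_exp_line (g : R -> R) (C s : R) : measurable_fun setT g ->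
  (forall x, 0 <= g x) -> (forall x, g x <= C) -> 0 < s ->
  (\int[mu]_z (g z *
     expR (- (s * (`|z| * Rintegral mu `[0%R, 1%R] (fun t : R => g (t * z)%R)))))%:E
   <= (2 / s)%:E)%E.
Proof.
move=> mg g0 gC s0.
pose g' x := g (- x).
have mg' : measurable_fun setT g' by apply: measurableT_comp.
have g'0 x : 0 <= g' x by exact: g0.
have g'C x : g' x <= C by exact: gC.
have H0 f x : (forall x, 0 <= f x) -> (0 <= H f s x)%E.
  by move=> f0; rewrite lee_fin mulr_ge0// expR_ge0.
have mH' := measurable_exp_primitive _ _ s mg' g'0 g'C.
rewrite -(setUv `[0%R, +oo[%classic) ge0_integral_setU//=; last 4 first.
- exact: measurableC.
- by rewrite setUv; exact: measurable_exp_line mg g0 gC.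
- by move=> x _; rewrite lee_fin mulr_ge0// expR_ge0.
- by apply/disj_setPCl.
rewrite mulr_natl mulr2n EFinD; apply: leeD.
  rewrite [leLHS](_ : _ = \int[mu]_(x in `[0%R, +oo[) H g s x)%E.
    exact: integral_exp_le _ C _ mg g0 gC s0.
  apply: eq_integral => x; rewrite mem_setE in_itv/= andbT => x0.
  by rewrite (exp_line_half_lines _ C)// x0.
rewrite setCitvr [leLHS](_ : _ = \int[mu]_(x in `]-oo, 0%R[) H g' s (- x)%R)%E; last first.
  apply: eq_integral => x; rewrite mem_setE in_itv/= => x0.
  by rewrite (exp_line_half_lines _ C)// leNgt x0.
rewrite integral_itv_bndo_bndc; last by apply: measurable_funTS; apply: measurableT_comp.
rewrite -ge0_integration_by_substitution0//; last by move=> x; exact: H0.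
exact: integral_exp_le _ C _ mg' g'0 g'C s0.
Qed.

End exp_bound_line.

(** * The integral of [(1 + a^2 + b^2)^(-3/2)] *)

(** On nonnegative reals the inverse is the power [-1], even at [0] by convention, and powers are
    measurable. *)
Lemma measurable_fun_invr d (T : measurableType d) (R : realType) (D : set T)
    (f : T -> R) : (forall x, 0 <= f x) -> measurable_fun D f ->
  measurable_fun D (fun x => (f x)^-1).
Proof.
move=> f0 mf; under eq_fun do rewrite -powR_inv1//.
exact: measurableT_comp (measurable_powR _) mf.
Qed.

Lemma measurable_fun_sqrtr d (T : measurableType d) (R : realType) (D : set T)
    (f : T -> R) : measurable_fun D f -> measurable_fun D (fun x => Num.sqrt (f x)).
Proof.
apply: measurableT_comp; apply: continuous_measurable_fun.
exact: sqrt_continuous.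
Qed.

Section inv_cube.
Context {R : realType}.
Local Notation mu := (@lebesgue_measure R).

Lemma sqrt_gt0_add_sqr (c x : R) : 0 < c -> 0 < Num.sqrt (c + x ^+ 2).
Proof. by move=> c0; rewrite sqrtr_gt0 ltr_pwDl// sqr_ge0. Qed.

Lemma continuous_inv_sqrt_cube (c : R) : 0 < c ->
  continuous (fun x : R => (Num.sqrt (c + x ^+ 2) ^+ 3)^-1).
Proof.
move=> c0.
have cq : continuous (fun x : R => Num.sqrt (c + x ^+ 2)).
  move=> x; apply: (@continuous_comp _ _ _ (fun x : R => c + x ^+ 2) Num.sqrt).
    by apply: cvgD; [exact: cvg_cst|exact: exprn_continuous].
  exact: sqrt_continuous.
move=> x; apply: cvgV; first by rewrite expf_neq0// gt_eqF// sqrt_gt0_add_sqr.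
exact: (@continuous_comp _ _ _ (fun x : R => Num.sqrt (c + x ^+ 2))
  (fun y : R => y ^+ 3) x (cq x) (@exprn_continuous _ 3 _)).
Qed.

(** With [q = sqrt (c + x^2)] the quotient rule gives [(q^2 - x^2) / (c q^3)], and the numerator is
    [c]. *)
Lemma is_derive_div_sqrt (c x : R) : 0 < c ->
  is_derive x 1 (fun x => x / (c * Num.sqrt (c + x ^+ 2)))
    (Num.sqrt (c + x ^+ 2) ^+ 3)^-1.
Proof.
move=> c0.
have q0 := sqrt_gt0_add_sqr _ x c0.
have d1 : is_derive x 1 (fun x : R => c + x ^+ 2) (2 * x).
  have -> : (fun x : R => c + x ^+ 2) = cst c + (id * id) by apply/funext => y; rewrite expr2.
  apply: is_derive_eq.
  by rewrite add0r /GRing.scale /= mulr1 mulr_natl.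
have d2 : is_derive (c + x ^+ 2) 1 Num.sqrt (2 * Num.sqrt (c + x ^+ 2))^-1.
  by apply: is_derive1_sqrt; rewrite ltr_pwDl// sqr_ge0.
have d3 : is_derive x 1 (fun x => c * Num.sqrt (c + x ^+ 2))
   (c * ((2 * Num.sqrt (c + x ^+ 2))^-1 * (2 * x))).
  exact: (is_deriveZ c (@is_derive1_comp _ Num.sqrt (fun x : R => c + x ^+ 2) _ _ _ d2 d1)).
have cq0 : c * Num.sqrt (c + x ^+ 2) != 0 by rewrite mulf_neq0// gt_eqF.
have d4 := is_deriveM (is_derive_id x 1)
  (is_deriveV (f := fun x : R => c * Num.sqrt (c + x ^+ 2)) cq0 d3).
apply: (is_derive_eq d4).
rewrite /= /GRing.scale /=.
have qq : Num.sqrt (c + x ^+ 2) ^+ 2 = c + x ^+ 2.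
  by rewrite sqr_sqrtr// addr_ge0 ?sqr_ge0// ltW.
move: (Num.sqrt _) q0 qq {d1 d2 d3 d4 cq0} => q q0 qq.
(* Eliminating [c] turns the goal into a rational identity in [q] and [x]. *)
have -> : c = q ^+ 2 - x ^+ 2 by rewrite qq addrK.
by field; rewrite qq addrK !gt_eqF.
Qed.

(** With [q = sqrt (c + x^2)], the gap to the limit is [(q - x) / (c q) = 1 / (q (q + x))], because
    [(q - x) (q + x) = c]. It is at most [e] once [x] exceeds both [1] and [1 / e]. *)
Lemma cvgy_div_sqrt (c : R) : 0 < c ->
  x / (c * Num.sqrt (c + x ^+ 2)) @[x --> +oo] --> c^-1.
Proof.
move=> c0; apply/cvgrPdist_le => e e0; near=> x.
have x1 : 1 <= x by near: x; apply: nbhs_pinfty_ge; exact: num_real.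
have ex : e^-1 <= x by near: x; apply: nbhs_pinfty_ge; exact: num_real.
have q0 := sqrt_gt0_add_sqr _ x c0.
have qq : Num.sqrt (c + x ^+ 2) ^+ 2 = c + x ^+ 2.
  by rewrite sqr_sqrtr// addr_ge0 ?sqr_ge0// ltW.
move: (Num.sqrt _) q0 qq => q q0 qq.
have xq : x <= q.
  by rewrite leNgt; apply/negP => qx; nra.
have -> : c^-1 - x / (c * q) = (q - x) / (c * q) by field; rewrite !gt_eqF.
rewrite ger0_norm; last by rewrite divr_ge0 ?subr_ge0// mulr_ge0 ?ltW.
rewrite ler_pdivrMr ?mulr_gt0//.
have {}ex : 1 <= x * e by rewrite -ler_pdivrMr// mul1r.
have qx0 : 0 < q + x by lra.
rewrite -(ler_pM2r qx0).
have -> : (q - x) * (q + x) = c by rewrite -subr_sqr qq addrK.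
have h1 : 1 <= e * q by rewrite (le_trans ex)// mulrC ler_pM2l.
have -> : e * (c * q) * (q + x) = c * ((e * q) * (q + x)) by ring.
rewrite -[leLHS]mulr1 ler_pM2l//.
have h2 : 1 <= q + x by lra.
by rewrite -[leLHS]mulr1 ler_pM.
Unshelve. all: by end_near. Qed.

Lemma integral_inv_sqrt_cube (c : R) : 0 < c ->
  (\int[mu]_x ((Num.sqrt (c + x ^+ 2) ^+ 3)^-1)%:E = (2 / c)%:E)%E.
Proof.
move=> c0.
rewrite ge0_symfun_integralT; last 3 first.
- by move=> x; rewrite invr_ge0 exprn_ge0// sqrtr_ge0.
- exact: continuous_inv_sqrt_cube.
- by move=> x /=; rewrite sqrrN.
rewrite -set_itvcy (@ge0_continuous_FTC2y _ _ (fun x => x / (c * Num.sqrt (c + x ^+ 2))) 0 c^-1).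
- by rewrite mul0r sube0 -EFinM.
- by move=> x _; rewrite invr_ge0 exprn_ge0// sqrtr_ge0.
- exact/continuous_subspaceT/continuous_inv_sqrt_cube.
- exact: cvgy_div_sqrt.
- by move=> x _; have [] := is_derive_div_sqrt c x c0.
- apply: cvg_at_right_filter.
  by have [/derivable1_diffP/differentiable_continuous ? _] := is_derive_div_sqrt c 0 c0.
- by move=> x _; rewrite derive1E; have [] := is_derive_div_sqrt c x c0.
Qed.

Lemma measurable_inv_sqrt_cube2 : measurable_fun [set: R * R]
  (fun ab => (Num.sqrt (1 + ab.1 ^+ 2 + ab.2 ^+ 2) ^+ 3)^-1).
Proof.
apply: measurable_fun_invr => [x|]; first by rewrite exprn_ge0// sqrtr_ge0.
apply: measurable_funX; apply: measurable_fun_sqrtr.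
by apply: measurable_funD; [apply: measurable_funD => //|];
  apply: measurable_funX; [exact: measurable_fst|exact: measurable_snd].
Qed.

(** The inner integral, with [c = 1 + a^2], is [2 / (1 + a^2)]; by evenness the outer one is twice
    an arctangent integral, so the total is [2 * 2 * (pi / 2)]. *)
Lemma integral_inv_sqrt_cube2 :
  (\int[mu \x mu]_ab ((Num.sqrt (1 + ab.1 ^+ 2 + ab.2 ^+ 2) ^+ 3)^-1)%:E
    = (2 * pi)%:E)%E.
Proof.
rewrite fubini_tonelli1; last 2 first.
- by apply/measurable_EFinP; exact: measurable_inv_sqrt_cube2.
- by move=> x; rewrite lee_fin invr_ge0 exprn_ge0// sqrtr_ge0.
rewrite /fubini_F /=.
under eq_integral => a _ do rewrite integral_inv_sqrt_cube ?ltr_pwDl ?sqr_ge0//.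
under eq_integral do rewrite EFinM.
rewrite ge0_integralZl_EFin//; last 2 first.
- by move=> x _; rewrite lee_fin invr_ge0 addr_ge0// sqr_ge0.
- apply/measurable_EFinP; apply: continuous_measurable_fun; exact: continuous_oneDsqrV.
rewrite (@ge0_symfun_integralT _ (fun x => (oneDsqr x)^-1)); last 3 first.
- by move=> x; rewrite invr_ge0 addr_ge0// sqr_ge0.
- exact: continuous_oneDsqrV.
- by move=> x /=; rewrite /oneDsqr sqrrN.
rewrite -set_itvcy integral0y_oneDsqr -!EFinM; congr EFin.
by field.
Qed.

End inv_cube.

(** * Integration in central projection coordinates *)

(* The canonical sigma-finite structure on [m1 \x m2] that inference finds is
   the one for subprobabilities, hence this explicit instance. *)
Section product_sigma_finite.
Context d1 d2 (T1 : measurableType d1) (T2 : measurableType d2) (R : realType).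
Variables (m1 : {sigma_finite_measure set T1 -> \bar R})
          (m2 : {sigma_finite_measure set T2 -> \bar R}).

(** Products of two exhausting sequences are countably many rectangles of finite measure. [unpickle]
    enumerates the pairs of indices; numbers coding no pair get the empty set. *)
Lemma sigma_finite_product_measure : sigma_finite [set: T1 * T2] (m1 \x m2)%E.
Proof.
have [F TF Foo] := sigma_finiteT m1; have [G TG Goo] := sigma_finiteT m2.
exists (fun n => if (unpickle n : option (nat * nat)) is Some ij
                 then F ij.1 `*` G ij.2 else set0).
  apply/esym/seteqP; split => // -[x y] _.
  have [i _ Fx] : (\bigcup_k F k) x by rewrite -TF.
  have [j _ Gy] : (\bigcup_k G k) y by rewrite -TG.
  by exists (pickle (i, j)); rewrite ?pickleK.
move=> n; case: unpickle => [[i j]/=|]; last by split => //; rewrite measure0 ltry.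
have [mF Fi] := Foo i; have [mG Gj] := Goo j; split; first exact: measurableX.
rewrite product_measure1E//; apply: lte_mul_pinfty => //.
by rewrite ge0_fin_numE.
Qed.

Let sf := Measure_isSigmaFinite.Build _ _ _ (m1 \x m2)%E sigma_finite_product_measure.

Definition product_sigma_finite : {sigma_finite_measure set (T1 * T2)%type -> \bar R} :=
  HB.pack (m1 \x m2)%E sf.

End product_sigma_finite.
Arguments product_sigma_finite {d1 d2 T1 T2 R} m1 m2.

Definition lebesgue2 {R : realType} : {sigma_finite_measure
    set (measurableTypeR R * measurableTypeR R)%type -> \bar R} :=
  product_sigma_finite lebesgue_measure lebesgue_measure.

(** The measure [leb3], packaged with the sigma-finite structure that Tonelli requires. *)
Definition lebesgue3 {R : realType} : {sigma_finite_measure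
    set (measurableTypeR R * measurableTypeR R * measurableTypeR R)%type -> \bar R} :=
  product_sigma_finite lebesgue2 lebesgue_measure.

Ltac measurability := repeat (first
  [ assumption | exact measurable_id | exact measurable_fst | exact measurable_snd
  | (apply: measurable_cst)
  | (apply: measurable_fun_pair) | (apply: measurable_funB) | (apply: measurable_funD)
  | (apply: measurable_funM)
  | (apply: (measurableT_comp measurable_fst))
  | (apply: (measurableT_comp measurable_snd)) ]).

Section cone.
Context {R : realType}.
Local Notation mu := (@lebesgue_measure R).

(** Tonelli allows one coordinate at a time, each contributing a factor [|c|]. For a slice at height
    [z] of the cone coordinates this is the volume factor [z^2]. *)
Lemma ge0_integral_affine2 (c : R) (d : R * R) (F : R * R -> \bar R) : c != 0 ->
  measurable_fun setT F -> (forall p, 0 <= F p)%E ->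
  (\int[mu \x mu]_p F p = (c ^+ 2)%:E *
   \int[mu \x mu]_p F (d.1 + c * p.1, d.2 + c * p.2)%R)%E.
Proof.
move=> c0 mF F0.
have mFc : measurable_fun setT (fun p : R * R => F (d.1 + c * p.1, d.2 + c * p.2)).
  apply: measurableT_comp; first exact: mF.
  measurability.
rewrite !fubini_tonelli1//.
rewrite (@ge0_integral_affine R c d.1)//; last 2 first.
- exact: measurable_fun_fubini_tonelli_F.
- by move=> x; exact: integral_ge0.
rewrite -[c ^+ 2]real_normK ?num_real// expr2 EFinM -muleA; congr (_ * _)%E.
rewrite -ge0_integralZl_EFin//; last 2 first.
- by move=> x _; exact: integral_ge0.
- exact: measurable_fun_fubini_tonelli_F.
apply: eq_integral => x _.
rewrite /fubini_F (@ge0_integral_affine R c d.2)//.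
exact: measurable_fun_pair2.
Qed.

Lemma measurable_cone (r : pt R) (F : pt R -> \bar R) : measurable_fun setT F ->
  measurable_fun setT (fun abz : (R * R) * R =>
    (abz.2 ^+ 2)%:E * F (padd r (pscale abz.2 (abz.1, 1%R))))%E.
Proof.
move=> mF; apply: emeasurable_funM.
  by apply/measurable_EFinP; apply: measurable_funX; exact: measurable_snd.
apply: measurableT_comp; first exact: mF.
by rewrite /padd /pscale /=; measurability.
Qed.

(** Tonelli moves [z] to the outside on both sides. The slice at height [z] above [r] is then a
    planar dilation by [z]. *)
Lemma ge0_integral_cone (r : pt R) (F : pt R -> \bar R) :
  measurable_fun setT F -> (forall p, 0 <= F p)%E ->
  (\int[leb3]_x F x = \int[mu \x mu]_ab \int[mu]_z
     ((z ^+ 2)%:E * F (padd r (pscale z (ab, 1%R)))))%E.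
Proof.
move=> mF F0.
have mK := measurable_cone r _ mF.
have K0 abz : (0 <= (abz.2 ^+ 2)%:E * F (padd r (pscale abz.2 (abz.1, 1%R))))%E.
  by rewrite mule_ge0// lee_fin sqr_ge0.
apply: (etrans _ (esym (fubini_tonelli (m1 := lebesgue2) (m2 := mu) _ mK K0))).
rewrite (fubini_tonelli2 (m1 := lebesgue2) (m2 := mu))//.
rewrite (@ge0_integral_affine R 1 r.2) ?oner_eq0//; last 2 first.
- exact: measurable_fun_fubini_tonelli_G.
- by move=> x; exact: integral_ge0.
rewrite normr1 mul1e.
have mFr : measurable_fun setT (fun z : R => fubini_G lebesgue2 F (r.2 + 1 * z)%R).
  have mG : measurable_fun setT (fubini_G lebesgue2 F).
    exact: measurable_fun_fubini_tonelli_G.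
  have mz : measurable_fun setT (fun z : R => r.2 + 1 * z) by measurability.
  exact: measurableT_comp mG mz.
(* At [z = 0] the dilation degenerates; this single height is null and is removed on both sides. *)
rewrite -(integral_setD1 (r := 0)); [|exact: measurableD|exact: measurable_funTS].
rewrite -[RHS](integral_setD1 (r := 0)); first last.
- apply: measurable_funTS.
  exact: (measurable_fun_fubini_tonelli_G (m1 := lebesgue2) _ mK K0).
- exact: measurableD.
apply: eq_integral => z /set_mem [_ /= /eqP z0].
rewrite mul1r /fubini_G (@ge0_integral_affine2 z r.1)//; last exact: measurable_fun_pair1.
rewrite ge0_integralZl_EFin ?sqr_ge0//.
  congr (_ * _)%E.
  by apply: eq_integral => p _; rewrite /padd /pscale /= mulr1.
apply: measurableT_comp; first exact: mF.
rewrite /padd /pscale /=; measurability.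
Qed.

End cone.

(** * The transport kernel *)

Section kernel.
Context {R : realType}.
Local Notation mu := (@lebesgue_measure R).

Lemma enorm_scale (z : R) (p : pt R) : enorm (pscale z p) = `|z| * enorm p.
Proof.
rewrite /enorm /pscale /= !exprMn -!mulrDr sqrtrM ?sqr_ge0//.
by rewrite sqrtr_sqr.
Qed.

Lemma enorm_psubC (p q : pt R) : enorm (psub p q) = enorm (psub q p).
Proof. by rewrite /enorm /psub /=; congr Num.sqrt; ring. Qed.

Variable f : pt R -> R.
Hypotheses (mf : measurable_fun setT f) (f0 : forall x, 0 <= f x).

Lemma kern_ge0 (sig : pt R -> R) (r x : pt R) : 0 <= kern sig r x.
Proof.
rewrite /kern mulr_ge0 ?expR_ge0// invr_ge0 mulr_ge0 ?sqr_ge0//.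
by rewrite mulr_ge0// pi_ge0.
Qed.

(** The substitution [t |-> 1 - t] reverses the segment. *)
Lemma tauC (r x : pt R) : tau f r x = tau f x r.
Proof.
rewrite /tau (enorm_psubC r x); congr (_ * _).
rewrite /Rintegral; congr fine; rewrite [LHS]integral_mkcond [RHS]integral_mkcond.
have ms : measurable_fun setT (fun t : R => f (padd r (pscale t (psub x r)))).
  apply: measurableT_comp; first exact: mf.
  by rewrite /padd /pscale /=; measurability.
rewrite (@ge0_integral_affine R (-1) 1) ?oppr_eq0 ?oner_eq0//; last 2 first.
- by apply/(measurable_restrictT _ _).1 => //; exact/measurable_EFinP/measurable_funTS.
- by move=> t; rewrite patchE; case: ifPn => // _; rewrite lee_fin.
rewrite normrN1 mul1e; apply: eq_integral => t _.
rewrite !patchE.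
have -> : (1 + -1 * t \in `[0, 1]%classic) = (t \in `[0, 1]%classic).
  by rewrite !mem_setE !in_itv/=; apply/andP/andP => -[? ?]; split; lra.
case: ifPn => // _; congr (f _)%:E.
by rewrite /padd /pscale /psub /=; congr (_, _, _); ring.
Qed.

Lemma kernC (r x : pt R) : kern f r x = kern f x r.
Proof. by rewrite /kern tauC enorm_psubC. Qed.

(** The segment integral is a section integral of a function jointly measurable in both end points
    and the parameter, so Tonelli makes it measurable in the end points. *)
Lemma measurable_kern : measurable_fun setT (fun p : pt R * pt R => kern f p.1 p.2).
Proof.
have me : measurable_fun setT (fun p : pt R * pt R => enorm (psub p.1 p.2)).
  apply: measurable_fun_sqrtr; rewrite /psub /=.
  by apply: measurable_funD; [apply: measurable_funD|];
    apply: measurable_funX; measurability.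
have mtau : measurable_fun setT (fun p : pt R * pt R => tau f p.1 p.2).
  apply: measurable_funM; last by under eq_fun do rewrite enorm_psubC.
  (* The indicator of [[0, 1]] extends the parameter to the whole line. *)
  pose h (pt : (pt R * pt R) * R) :=
    (f (padd pt.1.1 (pscale pt.2 (psub pt.1.2 pt.1.1))) * \1_(`[0, 1]%classic : set R) pt.2)%:E.
  have mh : measurable_fun setT h.
    apply/measurable_EFinP/measurable_funM.
      apply: measurableT_comp; first exact: mf.
      by rewrite /padd /pscale /psub /=; measurability.
    by apply: measurableT_comp => //; exact: measurable_snd.
  have h0 p : (0 <= h p)%E by rewrite lee_fin mulr_ge0.
  have mF := measurable_fun_fubini_tonelli_F (m2 := mu) h mh h0.
  have : measurable_fun setT (fine \o fubini_F mu h) by exact: measurableT_comp.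
  apply: eq_measurable_fun => p _ /=.
  rewrite /Rintegral; congr fine; rewrite [RHS]integral_mkcond.
  apply: eq_integral => t _; rewrite /h patchE indicE.
  by case: ifPn => _ /=; rewrite ?mulr1 ?mulr0.
apply: measurable_funM.
  by apply: measurableT_comp => //; exact: measurableT_comp.
apply: measurable_fun_invr => [p|].
  by rewrite mulr_ge0 ?sqr_ge0// mulr_ge0// pi_ge0.
by apply: measurable_funM => //; exact: measurable_funX.
Qed.

End kernel.

(** * Normalisation of the transport kernel *)

Section kernel_bound.
Context {R : realType}.
Local Notation mu := (@lebesgue_measure R).
Variables (f : pt R -> R) (C : R).
Hypotheses (mf : measurable_fun setT f) (f0 : forall x, 0 <= f x)
  (fC : forall x, f x <= C).

(* Not an equality at [z = 0], where [kern f r r = 0] because [1 / 0 = 0]. *)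
Lemma kern_cone (r : pt R) (ab : R * R) (z : R) (q := enorm (ab, 1))
    (g := fun t => f (padd r (pscale t (ab, 1)))) (x := padd r (pscale z (ab, 1))) :
  z ^+ 2 * (kern f r x * f x) <= (4 * pi * q ^+ 2)^-1 *
    (g z * expR (- (q * (`|z| * Rintegral mu `[0, 1] (fun t : R => g (t * z)))))).
Proof.
rewrite /kern /tau (enorm_psubC r x).
have -> : psub x r = pscale z (ab, 1).
  by rewrite /x /psub /padd /pscale /=; congr (_, _, _); ring.
rewrite enorm_scale -/q.
have -> : Rintegral (@leb1 R) `[0, 1] (fun t => f (padd r (pscale t (pscale z (ab, 1)))))
   = Rintegral mu `[0, 1] (fun t => g (t * z)).
  apply: eq_Rintegral => t _; rewrite /g; congr f.
  by rewrite /padd /pscale /=; congr (_, _, _); ring.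
set I := Rintegral _ _ _.
have q0 : 0 < q by rewrite /q /enorm sqrtr_gt0 /= expr1n ltr_wpDl// addr_ge0// sqr_ge0.
have [->|z0] := eqVneq z 0.
  rewrite expr0n /= mul0r; apply: mulr_ge0.
    by rewrite invr_ge0 mulr_ge0 ?sqr_ge0// mulr_ge0// pi_ge0.
  by apply: mulr_ge0; [exact: f0|exact: expR_ge0].
rewrite -/(g z) (_ : I * (`|z| * q) = q * (`|z| * I)); last by ring.
rewrite le_eqVlt; apply/orP; left; apply/eqP.
rewrite exprMn real_normK ?num_real//.
have := @pi_gt0 R; move: (expR _) pi => E p p0.
by field; rewrite z0 !gt_eqF.
Qed.

(** For each [(a, b)] the line bound [2 / q] meets the factor [1 / (4 pi q^2)] and leaves
    [1 / (2 pi q^3)], whose integral over the plane is [1]. *)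
Lemma integral_kern_le1 (r : pt R) :
  (\int[leb3]_x (kern f r x * f x)%:E <= 1)%E.
Proof.
have mk : measurable_fun setT (fun x : pt R => (kern f r x * f x)%:E).
  apply/measurable_EFinP/measurable_funM; last exact: mf.
  exact: (measurable_fun_pair2 r (measurable_kern _ mf f0)).
have k0 x : (0 <= (kern f r x * f x)%:E)%E by rewrite lee_fin mulr_ge0// kern_ge0.
rewrite (ge0_integral_cone r)//.
have mK := measurable_cone r _ mk.
have K0 abz : (0 <= (abz.2 ^+ 2)%:E * (kern f r (padd r (pscale abz.2 (abz.1, 1%R)))
    * f (padd r (pscale abz.2 (abz.1, 1%R))))%:E)%E.
  by rewrite mule_ge0// lee_fin sqr_ge0.
have pi20 : 0 <= (2 * pi)^-1 :> R by rewrite invr_ge0 mulr_ge0// pi_ge0.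
apply: (@le_trans _ _ (\int[(mu \x mu)%E]_ab ((2 * pi)^-1 *
     (Num.sqrt (1 + ab.1 ^+ 2 + ab.2 ^+ 2) ^+ 3)^-1)%:E)%E).
  apply: ge0_le_integral => //.
  - by move=> ab _; apply: integral_ge0 => z _; exact: (K0 (ab, z)).
  - exact: (measurable_fun_fubini_tonelli_F (m2 := mu) _ mK K0).
  - by apply/measurable_EFinP/measurable_funM => //; exact: measurable_inv_sqrt_cube2.
  move=> ab _.
  (* [q] converts height into arc length along the ray, and [g] is the profile of [f] on that ray by
     height. *)
  pose q := enorm (ab, 1); pose g t := f (padd r (pscale t (ab, 1))).
  have q0 : 0 < q by rewrite /q /enorm sqrtr_gt0 /= expr1n ltr_wpDl// addr_ge0// sqr_ge0.
  have mg : measurable_fun setT g.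
    apply: measurableT_comp; first exact: mf.
    by rewrite /padd /pscale /=; measurability.
  have g0 t : 0 <= g t by exact: f0.
  have gC t : g t <= C by exact: fC.
  have c0 : 0 <= (4 * pi * q ^+ 2)^-1.
    by rewrite invr_ge0 mulr_ge0 ?sqr_ge0// mulr_ge0// pi_ge0.
  have mE := measurable_exp_line g C q mg g0 gC.
  apply: (@le_trans _ _ (\int[mu]_z ((4 * pi * q ^+ 2)^-1%:E *
    (g z * expR (- (q * (`|z| * Rintegral mu `[0%R, 1%R] (fun t : R => g (t * z)%R)))))%:E))%E).
    apply: ge0_le_integral => //.
    - by move=> z _; exact: (K0 (ab, z)).
    - exact: (measurable_fun_pair2 ab mK).
    - exact: measurable_funeM.
    - by move=> z _; rewrite -!EFinM lee_fin; exact: kern_cone.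
  rewrite ge0_integralZl_EFin//; last first.
    by move=> z _; rewrite lee_fin mulr_ge0// expR_ge0.
  apply: (le_trans (lee_wpmul2l _ (integral_exp_line g C q mg g0 gC q0))).
    by rewrite lee_fin.
  rewrite -EFinM lee_fin le_eqVlt; apply/orP; left; apply/eqP.
  have -> : Num.sqrt (1 + ab.1 ^+ 2 + ab.2 ^+ 2) = q.
    by rewrite /q /enorm /=; congr Num.sqrt; ring.
  have := @pi_gt0 R; move: q q0 pi {c0 mE pi20} => q q0 p p0.
  by field; rewrite !gt_eqF.
under eq_integral do rewrite EFinM.
rewrite ge0_integralZl_EFin//; last first.
  by apply/measurable_EFinP; exact: measurable_inv_sqrt_cube2.
by rewrite integral_inv_sqrt_cube2 -EFinM mulVf// gt_eqF// mulr_gt0// pi_gt0.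
Qed.

End kernel_bound.

(** * Schur test *)

Section schur.
Local Open Scope ereal_scope.
Context d (T : measurableType d) (R : realType).
Variable m : {sigma_finite_measure set T -> \bar R}.
Variables (k : T * T -> R) (f w : T -> R).
Hypotheses (mk : measurable_fun setT k) (mf : measurable_fun setT f)
  (mw : measurable_fun setT w).
Hypotheses (k0 : forall p, (0 <= k p)%R) (f0 : forall x, (0 <= f x)%R)
  (w0 : forall x, (0 <= w x)%R).
Hypothesis kC : forall x y, k (x, y) = k (y, x).
Hypothesis kf1 : forall x, \int[m]_y (k (x, y) * f y)%:E <= 1.

(* Cauchy-Schwarz without square roots: integrate [2 l w <= l^2 + w^2] and take
   for [l] the integral itself. *)
Lemma sqr_integral_le x :
  (\int[m]_y (k (x, y) * f y * w y)%:E) * (\int[m]_y (k (x, y) * f y * w y)%:E) <=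
  \int[m]_y (k (x, y) * f y * w y ^+ 2)%:E.
Proof.
have mkx : measurable_fun setT (fun y => k (x, y)) by exact: measurable_fun_pair2.
have mkf : measurable_fun setT (fun y => (k (x, y) * f y)%R) by exact: measurable_funM.
have mkw : measurable_fun setT (fun y => (k (x, y) * f y * w y)%R).
  exact: measurable_funM.
have mkw2 : measurable_fun setT (fun y => (k (x, y) * f y * w y ^+ 2)%R).
  by apply: measurable_funM => //; exact: measurable_funX.
set A := \int[m]_y (k (x, y) * f y * w y)%:E.
set B := \int[m]_y (k (x, y) * f y * w y ^+ 2)%:E.
have A0 : 0 <= A by apply: integral_ge0 => y _; rewrite lee_fin !mulr_ge0.
have B0 : 0 <= B.
  by apply: integral_ge0 => y _; rewrite lee_fin mulr_ge0 ?sqr_ge0// mulr_ge0.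
have key (l : R) : (0 <= l)%R -> (2 * l)%:E * A <= (l ^+ 2)%:E + B.
  move=> l0.
  have <- : \int[m]_y ((2 * l)%:E * (k (x, y) * f y * w y)%:E) = (2 * l)%:E * A.
    rewrite ge0_integralZl_EFin//; last by rewrite mulr_ge0.
    - by move=> y _; rewrite lee_fin !mulr_ge0.
    - exact/measurable_EFinP.
  apply: (@le_trans _ _ (\int[m]_y ((l ^+ 2)%:E * (k (x, y) * f y)%:E +
      (k (x, y) * f y * w y ^+ 2)%:E))).
    apply: ge0_le_integral => //.
    - by move=> y _; rewrite -EFinM lee_fin !mulr_ge0.
    - by apply: measurable_funeM; exact/measurable_EFinP.
    - apply: emeasurable_funD; last exact/measurable_EFinP.
      by apply: measurable_funeM; exact/measurable_EFinP.
    - move=> y _; rewrite -!EFinM -EFinD lee_fin.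
      have := mulr_ge0 (mulr_ge0 (k0 (x, y)) (f0 y)) (sqr_ge0 (l - w y)); lra.
  rewrite ge0_integralD//; first last.
  - exact/measurable_EFinP.
  - by move=> y _; rewrite lee_fin mulr_ge0 ?sqr_ge0// mulr_ge0.
  - by apply: measurable_funeM; exact/measurable_EFinP.
  - by move=> y _; rewrite -EFinM lee_fin mulr_ge0 ?sqr_ge0// mulr_ge0.
  rewrite leeD2r// ge0_integralZl_EFin ?sqr_ge0//; first last.
  - exact/measurable_EFinP.
  - by move=> y _; rewrite lee_fin mulr_ge0.
  by rewrite -[leRHS]mule1 lee_wpmul2l// lee_fin sqr_ge0.
(* If [B] is infinite there is nothing to prove. If both are finite, [l = A] gives
   [2 A^2 <= A^2 + B]; if only [A] is infinite, [l = 1] is contradictory. *)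
move: A B A0 B0 key => [a| |] [b| |]//= a0 b0 key; rewrite ?leey//.
- have := key a; rewrite -!EFinM -EFinD !lee_fin => h.
  have := h a0; nra.
- have := key 1%R ler01; rewrite mulr1 -EFinD => h.
  by move: h; rewrite mulry gtr0_sg// mul1e.
Qed.

(** The mass bound [kf1] is used twice: in the pointwise Cauchy-Schwarz inequality, and again after
    Tonelli, where symmetry of [k] transfers it to the other variable. *)
Lemma schur_test :
  \int[m]_x ((f x)%:E * ((\int[m]_y (k (x, y) * f y * w y)%:E) *
                        (\int[m]_y (k (x, y) * f y * w y)%:E))) <=
  \int[m]_y (f y * w y ^+ 2)%:E.
Proof.
pose h (p : T * T) := (f p.1 * (k p * f p.2 * w p.2 ^+ 2))%:E.
have mf1 : measurable_fun setT (fun p : T * T => f p.1) by exact: measurableT_comp.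
have mf2 : measurable_fun setT (fun p : T * T => f p.2) by exact: measurableT_comp.
have mw2 : measurable_fun setT (fun p : T * T => w p.2) by exact: measurableT_comp.
have mh : measurable_fun setT h.
  apply/measurable_EFinP; apply: measurable_funM => //; apply: measurable_funM.
    exact: measurable_funM.
  exact: measurable_funX.
have h0 p : 0 <= h p by rewrite lee_fin !mulr_ge0// sqr_ge0.
have mkw : measurable_fun setT (fun x => \int[m]_y (k (x, y) * f y * w y)%:E).
  apply: (measurable_fun_fubini_tonelli_F (m2 := m)
    (fun p : T * T => (k p * f p.2 * w p.2)%:E)).
    by apply/measurable_EFinP; apply: measurable_funM => //; exact: measurable_funM.
  by move=> p; rewrite lee_fin !mulr_ge0.
have mE : measurable_fun setT (EFin \o f) by exact/measurable_EFinP.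
apply: (@le_trans _ _ (\int[m]_x \int[m]_y h (x, y))).
  apply: ge0_le_integral => //.
  - move=> x _; rewrite mule_ge0 ?lee_fin// mule_ge0//;
      by apply: integral_ge0 => y _; rewrite lee_fin !mulr_ge0.
  - by apply: emeasurable_funM => //; exact: emeasurable_funM.
  - exact: (measurable_fun_fubini_tonelli_F (m2 := m) _ mh h0).
  move=> x _; apply: (@le_trans _ _ ((f x)%:E *
      \int[m]_y (k (x, y) * f y * w y ^+ 2)%:E)).
    by apply: lee_wpmul2l; [rewrite lee_fin|exact: sqr_integral_le].
  rewrite -ge0_integralZl_EFin//.
  - by move=> y _; rewrite lee_fin mulr_ge0 ?sqr_ge0// mulr_ge0.
  - apply/measurable_EFinP; apply: measurable_funM; last exact: measurable_funX.
    by apply: measurable_funM => //; exact: measurable_fun_pair2.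
rewrite fubini_tonelli//.
apply: ge0_le_integral => //.
- by move=> y _; apply: integral_ge0.
- exact: (measurable_fun_fubini_tonelli_G (m1 := m) _ mh h0).
- by apply/measurable_EFinP; apply: measurable_funM => //; exact: measurable_funX.
move=> y _.
(* By symmetry, the integral over [x] becomes the mass of the kernel at [y]. *)
rewrite (eq_integral (fun x => (f y * w y ^+ 2)%:E * (k (y, x) * f x)%:E)); last first.
  by move=> x _; rewrite /h /= kC -EFinM; congr EFin; ring.
rewrite ge0_integralZl_EFin//; first last.
- by rewrite mulr_ge0// sqr_ge0.
- by apply/measurable_EFinP; apply: measurable_funM => //; exact: measurable_fun_pair2.
- by move=> x _; rewrite lee_fin mulr_ge0.
by rewrite -[leRHS]mule1 lee_wpmul2l// lee_fin mulr_ge0// sqr_ge0.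
Qed.

End schur.

(** * The operator bound *)

Lemma ae_mono d (T : measurableType d) (R : realType)
    (mu : {measure set T -> \bar R}) (P Q : T -> Prop) : (forall x, P x -> Q x) ->
  {ae mu, forall x, P x} -> {ae mu, forall x, Q x}.
Proof. exact: filterS. Qed.

(** An exceptional set of the restricted measure has a null trace on [D], and this trace contains
    every failure inside [D]. *)
Lemma ae_mrestr d (T : measurableType d) (R : realType)
    (mu : {measure set T -> \bar R}) (D : set T) (mD : measurable D) (P : T -> Prop) :
  {ae mrestr mu mD, forall x, P x} -> {ae mu, forall x, D x -> P x}.
Proof.
move=> [N [mN N0 PN]]; exists (N `&` D); split => //.
  exact: measurableI.
by move=> x /= /not_implyP[Dx nPx]; split => //; exact: PN.
Qed.

(** Convexity enters here: the segment stays in [V], where the extension by zero agrees with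
    [sig]. *)
Lemma tau_patch (R : realType) (V : set (pt R)) (sig : pt R -> R) (r x : pt R) :
  convex_set3 V -> V r -> V x -> tau (sig \_ V) r x = tau sig r x.
Proof.
move=> cV Vr Vx; rewrite /tau; congr (_ * _); apply: eq_Rintegral => t.
rewrite mem_setE in_itv/= => t01; rewrite patchE mem_set//.
exact: cV.
Qed.

(** Tonelli covers nonnegative integrands; the split into positive and negative parts admits a
    function [v] of any sign. *)
Lemma measurable_fun_integral d1 d2 (T1 : measurableType d1) (T2 : measurableType d2)
    (R : realType) (m2 : {sigma_finite_measure set T2 -> \bar R})
    (h : T1 * T2 -> \bar R) : measurable_fun setT h ->
  measurable_fun setT (fun x => \int[m2]_y h (x, y))%E.
Proof.
move=> mh; under eq_fun do rewrite integralE.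
apply: emeasurable_funB.
- have mp : measurable_fun setT (h^\+)%E by exact: measurable_funepos.
  apply: eq_measurable_fun (measurable_fun_fubini_tonelli_F (m2 := m2) _ mp
    (fun x => funepos_ge0 h x)).
  by move=> x _; apply: eq_integral => y _; rewrite !funeposE.
- have mn : measurable_fun setT (h^\-)%E by exact: measurable_funeneg.
  apply: eq_measurable_fun (measurable_fun_fubini_tonelli_F (m2 := m2) _ mn
    (fun x => funeneg_ge0 h x)).
  by move=> x _; apply: eq_integral => y _; rewrite !funenegE.
Qed.

(** * Weighted bound when [|sigstar| <= m sig] almost everywhere on [V] *)

Section weighted_bound.
Context {R : realType}.
Variables (V : set (pt R)) (sig sigstar v : pt R -> R) (C m : R).
Hypotheses (mV : measurable V) (cV : convex_set3 V).
Hypotheses (msig : measurable_fun V sig) (mss : measurable_fun V sigstar)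
  (mv : measurable_fun V v).
Hypotheses (sig0 : forall x, V x -> 0 <= sig x) (C0 : 0 <= C)
  (sigC : forall x, V x -> sig x <= C).
Hypotheses (m0 : 0 <= m)
  (hm : {ae leb3, forall x, V x -> `|sigstar x| <= m * sig x}).

(** Extensions by zero, since the kernel estimate and the Schur test live on the whole space. *)
Let f := sig \_ V.
Let w := (fun x => `|v x|) \_ V.
Let k (p : pt R * pt R) := kern f p.1 p.2.
(** The operator with [sig] in place of [sigstar], applied to [|v|]. As an extended real it is
    meaningful before any integrability is known. *)
Let A r : \bar R := (\int[leb3]_x (k (r, x) * f x * w x)%:E)%E.

Let fE x : V x -> f x = sig x. Proof. by move=> Vx; rewrite /f patchE mem_set. Qed.
Let wE x : V x -> w x = `|v x|. Proof. by move=> Vx; rewrite /w patchE mem_set. Qed.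
Let wN x : ~ V x -> w x = 0. Proof. by move=> Vx; rewrite /w patchE memNset. Qed.

Let f0 x : 0 <= f x.
Proof. by rewrite /f patchE; case: ifPn => // /set_mem; exact: sig0. Qed.
Let fC x : f x <= C.
Proof. by rewrite /f patchE; case: ifPn => // /set_mem; exact: sigC. Qed.
Let w0 x : 0 <= w x.
Proof. by rewrite /w patchE; case: ifPn. Qed.
Let mf : measurable_fun setT f.
Proof. exact: (measurable_restrictT sig mV).1 msig. Qed.
Let mw : measurable_fun setT w.
Proof.
have mnv : measurable_fun V (fun x => `|v x|) by apply: measurableT_comp => //.
exact: (measurable_restrictT _ mV).1 mnv.
Qed.
Let mk : measurable_fun setT k.
Proof. exact: measurable_kern mf f0. Qed.
Let k0 p : 0 <= k p. Proof. exact: kern_ge0. Qed.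

Let kE r x : V r -> V x -> k (r, x) = kern sig r x.
Proof. by move=> Vr Vx; rewrite /k /kern (tau_patch _ _ _ _ _ cV Vr Vx). Qed.

Let kfw0 r x : 0 <= k (r, x) * f x * w x.
Proof. exact: mulr_ge0 (mulr_ge0 (k0 _) (f0 _)) (w0 _). Qed.

Let A0 r : (0 <= A r)%E.
Proof. by apply: integral_ge0 => x _; rewrite lee_fin. Qed.

Let mA : measurable_fun setT A.
Proof.
apply: (measurable_fun_integral _ _ _ _ _ lebesgue3
  (fun p : pt R * pt R => (k p * f p.2 * w p.2)%:E)).
by apply/measurable_EFinP; apply: measurable_funM; [apply: measurable_funM|];
  by [|exact: measurableT_comp].
Qed.

Lemma integral_patch_setT r : A r = (\int[leb3]_(x in V) (k (r, x) * f x * w x)%:E)%E.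
Proof.
rewrite [RHS]integral_mkcond; apply: eq_integral => x _; rewrite patchE.
by case: ifPn => // /negP; rewrite inE => Vx; rewrite wN// mulr0.
Qed.

(** The triangle inequality and the almost-everywhere bound on [sigstar] reduce the operator to [A],
    to which the Schur test applies. *)
Lemma normr_Ksig_le r : V r -> ((`|Ksig V sig sigstar v r|)%:E <= m%:E * A r)%E.
Proof.
move=> Vr; rewrite /Ksig /Kop /Rintegral.
(* [fine] sends infinite values to [0], so the inequality also covers points where the integral
   defining the operator is infinite. *)
have le_fine_abse (X : \bar R) : (`|fine X|%:E <= `|X|)%E.
  by case: X => [x| |] //=; rewrite normr0 leey.
apply: (le_trans (le_fine_abse _)).
have mkr : measurable_fun V (fun x => k (r, x)).
  by apply: measurable_funTS; exact: measurable_fun_pair2.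
rewrite [leLHS](_ : _ = `|\int[leb3]_(x in V) (k (r, x) * (sigstar x * v x))%:E|)%E; last first.
  by apply: (congr1 abse); apply: eq_integral => x /set_mem Vx; rewrite kE.
have mI : measurable_fun V (fun x => (k (r, x) * (sigstar x * v x))%:E).
  by apply/measurable_EFinP; apply: measurable_funM => //; exact: measurable_funM.
apply: (le_trans (le_abse_integral leb3 mV mI)).
rewrite integral_patch_setT -ge0_integralZl_EFin//; last 2 first.
- by move=> x _; rewrite lee_fin.
- apply/measurable_EFinP; apply: measurable_funM; last exact: measurable_funTS.
  by apply: measurable_funM => //; exact: measurable_funTS.
apply: ae_ge0_le_integral => //.
- exact: measurableT_comp.
- by move=> x _; rewrite -EFinM lee_fin mulr_ge0.
- apply: measurable_funeM; apply/measurable_EFinP; apply: measurable_funM.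
    by apply: measurable_funM => //; exact: measurable_funTS.
  exact: measurable_funTS.
apply: ae_mono hm => x hx Vx.
rewrite -EFinM lee_fin normrM (ger0_norm (k0 _)) normrM fE// wE//.
move: (k (r, x)) (k0 (r, x)) => K K0.
rewrite (_ : m * (K * sig x * `|v x|) = K * (m * sig x * `|v x|)); last by ring.
by apply: ler_wpM2l => //; apply: ler_wpM2r => //; exact: hx.
Qed.

Lemma measurable_Ksig : measurable_fun V (Ksig V sig sigstar v).
Proof.
pose u := (fun x => sigstar x * v x) \_ V.
have mu' : measurable_fun setT u.
  have muv : measurable_fun V (fun x => sigstar x * v x) by exact: measurable_funM.
  exact: (measurable_restrictT _ mV).1 muv.
have mI : measurable_fun setT (fun r => \int[leb3]_x (k (r, x) * u x)%:E)%E.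
  apply: (measurable_fun_integral _ _ _ _ _ lebesgue3
    (fun p : pt R * pt R => (k p * u p.2)%:E)).
  by apply/measurable_EFinP; apply: measurable_funM => //; exact: measurableT_comp.
have : measurable_fun V (fun r => fine (\int[leb3]_x (k (r, x) * u x)%:E)%E).
  apply: measurable_funTS; exact: measurableT_comp mI.
apply: eq_measurable_fun => r /set_mem Vr.
rewrite /Ksig /Kop /Rintegral; congr fine; rewrite [RHS]integral_mkcond.
apply: eq_integral => x _; rewrite /u !patchE.
by case: ifPn => [/set_mem Vx|_]; rewrite ?mulr0 ?kE.
Qed.

(** The pointwise bound is squared and integrated against [sig]; enlarging [V] to the whole space
    only increases the integral, and the Schur test concludes. *)
Lemma wL2sq_Ksig_le :
  (wL2sq V sig (Ksig V sig sigstar v) <= (m * m)%:E * wL2sq V sig v)%E.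
Proof.
rewrite /wL2sq.
have mAA : measurable_fun setT (fun r => (f r)%:E * (A r * A r))%E.
  by apply: emeasurable_funM; [exact/measurable_EFinP|exact: emeasurable_funM].
have AA0 r : (0 <= (f r)%:E * (A r * A r))%E by rewrite !mule_ge0 ?lee_fin.
apply: (@le_trans _ _ (\int[leb3]_(r in V) ((m * m)%:E * ((f r)%:E * (A r * A r))))%E).
  apply: ge0_le_integral => //.
  - by move=> r Vr; rewrite lee_fin mulr_ge0 ?sqr_ge0// sig0.
  - apply/measurable_EFinP; apply: measurable_funM => //.
    apply: measurable_funX; apply: measurableT_comp => //; exact: measurable_Ksig.
  - by apply: measurable_funeM; exact: measurable_funTS.
  move=> r Vr; have h := normr_Ksig_le _ Vr.
  rewrite [leRHS](_ : _ = ((f r)%:E * ((m%:E * A r) * (m%:E * A r)))%E); last first.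
    by rewrite EFinM muleCA muleACA.
  move: (Ksig V sig sigstar v r) h => K h.
  rewrite mulrC expr2 !EFinM -(fE _ Vr).
  apply: lee_wpmul2l; first by rewrite lee_fin.
  by apply: lee_pmul => //; rewrite lee_fin.
rewrite ge0_integralZl_EFin//; last 2 first.
- exact: measurable_funTS.
- by rewrite mulr_ge0.
rewrite lee_wpmul2l ?lee_fin ?mulr_ge0//.
apply: (@le_trans _ _ (\int[leb3]_r ((f r)%:E * (A r * A r)))%E).
  exact: ge0_subset_integral.
have kC x y : k (x, y) = k (y, x) by exact: (kernC _ mf f0).
have kf1 x : (\int[leb3]_y (k (x, y) * f y)%:E <= 1)%E by exact: (integral_kern_le1 _ C mf f0 fC).
apply: (le_trans (schur_test _ _ _ lebesgue3 k f w mk mf mw k0 f0 w0 kC kf1)).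
(* [w] vanishes off [V], so the integral over the whole space is the weighted norm on [V]. *)
rewrite [leRHS]integral_mkcond le_eqVlt; apply/orP; left; apply/eqP.
apply: eq_integral => x _; rewrite patchE.
by case: ifPn => [/set_mem Vx|/negP]; [rewrite fE// wE// mulrC
  |rewrite inE => Vx; rewrite wN// expr0n mulr0].
Qed.

End weighted_bound.

Theorem theorem1 (R : realType) (V : set (pt R)) (mV : measurable V)
  (oV : open V) (neV : V !=set0) (cV : convex_set3 V) (bV : bounded_set3 V)
  (sigS sigA sigstar : pt R -> R)
  (sSmin sSmax sAmin sAmax ssmin ssmax : R)
  (msS : measurable_fun V sigS) (msA : measurable_fun V sigA)
  (mss : measurable_fun V sigstar)
  (hsS0 : 0 < sSmin) (hsS : forall r, V r -> sSmin <= sigS r <= sSmax)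
  (hsA0 : 0 < sAmin) (hsA : forall r, V r -> sAmin <= sigA r <= sAmax)
  (hss0 : 0 < ssmin) (hss : forall r, V r -> ssmin <= sigstar r <= ssmax) :
  let sig := fun r => sigS r + sigA r in
  let M := ess_sup (mrestr leb3 mV) (fun r => (`|sigstar r / sig r|)%:E) in
  forall v : pt R -> R, measurable_fun V v -> (wL2sq V sig v < +oo)%E ->
    (wL2sq V sig (Ksig V sig sigstar v) <= M * M * wL2sq V sig v)%E.
Proof.
move=> sig M v mv _.
have sig_gt0 x : V x -> 0 < sig x.
  by move=> Vx; have /andP[? _] := hsS _ Vx; have /andP[? _] := hsA _ Vx; rewrite /sig; lra.
have sigC x : V x -> sig x <= sSmax + sAmax.
  by move=> Vx; have /andP[_ ?] := hsS _ Vx; have /andP[_ ?] := hsA _ Vx; exact: lerD.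
have C0 : 0 <= sSmax + sAmax.
  by case: neV => x Vx; rewrite (le_trans _ (sigC _ Vx))// ltW// sig_gt0.
have msig : measurable_fun V sig by exact: measurable_funD.
have aeM := ae_mrestr _ _ _ _ _ _ _
  (ess_sup_ge (mrestr leb3 mV) (fun r => (`|sigstar r / sig r|)%:E)).
rewrite -/M in aeM.
(* Any real [m >= 0] above [M] bounds [sigstar / sig] almost everywhere on [V]; what remains is to
   take [m = M], which must first be a nonnegative real. *)
have bnd (m : R) : 0 <= m -> (M <= m%:E)%E ->
    (wL2sq V sig (Ksig V sig sigstar v) <= (m * m)%:E * wL2sq V sig v)%E.
  move=> m0 Mm; apply: (@wL2sq_Ksig_le _ _ _ _ _ (sSmax + sAmax)) => //.
    by move=> x Vx; rewrite ltW// sig_gt0.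
  apply: ae_mono aeM => x hx Vx.
  have := le_trans (hx Vx) Mm; rewrite lee_fin normrM normfV (gtr0_norm (sig_gt0 _ Vx)).
  by rewrite ler_pdivrMr// sig_gt0.
(* For [M <= 0], with [-oo] included, [m = 0] makes the left side at most [0], while [M * M] is
   nonnegative. *)
have RHS0 : (M <= 0)%E ->
    (wL2sq V sig (Ksig V sig sigstar v) <= M * M * wL2sq V sig v)%E.
  move=> M0; apply: (le_trans (bnd 0 (lexx _) M0)); rewrite mul0r mul0e.
  rewrite mule_ge0//; first exact: mule_le0.
  by apply: integral_ge0 => x Vx; rewrite lee_fin mulr_ge0 ?sqr_ge0// ltW// sig_gt0.
(* The numerator is at most [ssmax] and the denominator at least [sSmin + sAmin]. *)
have Mfin : (M < +oo)%E.
  apply: (@le_lt_trans _ _ (ssmax / (sSmin + sAmin))%:E); last exact: ltry.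
  rewrite /M ess_supEae; apply: ereal_inf_lbound => /=.
  (* The complement of [V] is null for the restricted measure, so the bound is to be checked on [V]
     alone. *)
  exists (~` V); split; first exact: measurableC.
    by rewrite /mrestr setICl measure0.
  move=> x /= h Vx; apply: h.
  have /andP[s1 _] := hsS _ Vx; have /andP[s2 _] := hsA _ Vx.
  have /andP[s3 s4] := hss _ Vx.
  rewrite lee_fin normrM normfV (gtr0_norm (sig_gt0 _ Vx)) gtr0_norm; last exact: lt_le_trans s3.
  apply: ler_pM => //; first exact: ltW (lt_le_trans hss0 s3).
    by rewrite invr_ge0 ltW// sig_gt0.
  rewrite lef_pV2 ?posrE; [exact: lerD|exact: sig_gt0|exact: addr_gt0].
have [M0|M0] := leP M 0%E; first exact: RHS0.
have -> : M = (fine M)%:E by rewrite fineK// gt0_fin_numE.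
rewrite -EFinM; apply: bnd; first by rewrite fine_ge0// ltW.
by rewrite fineK// gt0_fin_numE.
Qed.
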